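(* Assume $g(x,\xi)=\xi$. Let $N\ge 1$ and fix $\epsilon,\tilde\gamma,\delta\in(0,1)$ with $\delta\le1-(1-\epsilon)^{1/N}$. Let $\delta^{(i)}=\delta/n_P$ for $i\in[n_P]$, let the sample size $D$ satisfy $$D>\max_{i\in[n_P]}\frac{\log(\tilde\gamma/n_{\mathrm{tot}})}{\log(1-\delta^{(i)})},$$ and let $\tau_i=F_{\mathrm b}^{-1}\big(\tfrac{\tilde\gamma}{n_{\mathrm{tot}}};D,\delta^{(i)}\big)$ for $i\in[n_P]$. Let $\kappa_{\mathcal D}:\mathbb{R}^n\to U$ be a data-dependent control law. If for all $\mathcal D\in\operatorname{supp}(\mathcal D)$ and all $x\in S$ there exist indices $j_i\in[m_i]$, $i\in[n_P]$, with $$c_{ij_i}^\top f(x,\kappa_{\mathcal D}(x))-\tilde b_{ij_i}(x)\ \ge\ -Z^{ij_i}_{(\tau_i)}\qquad\text{for all } i\in[n_P],$$ then $$\mathbb{P}_\xi^{D}\big\{P_N(x;\kappa_{\mathcal D})\le\epsilon\big\}\ge1-\tilde\gamma\qquad\text{for all }x\in S .$$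
   Context: For $k\in\mathbb{N}$, $[k]=\{1,\dots,k\}$. Consider the system $x_{k+1}=F(x_k,u_k,\xi_k)=f(x_k,u_k)+\xi_k$, with states $x_k\in\mathbb{R}^n$, inputs $u_k\in U\subseteq\mathbb{R}^m$ ($U$ nonempty, closed, convex), and $(\xi_k)_k$ an i.i.d. sequence of $\mathbb{R}^n$-valued random variables with common law $\mathbb{P}_\xi$, with $\xi_k$ independent of the information available at time $k$. All maps are measurable. The constant $\alpha\in[0,1]$ is fixed. The function $h:\mathbb{R}^n\to\mathbb{R}$ is $$h(x)=\min_{i\in[n_P]}h_i(x),\qquad h_i(x)=\max_{j\in[m_i]}\big(c_{ij}^\top x-b_{ij}\big),$$ with $n_P,m_i\ge1$ integers, $c_{ij}\in\mathbb{R}^n$, $b_{ij}\in\mathbb{R}$; $n_{\mathrm{tot}}=\sum_{i\in[n_P]}m_i$; the safe set is $S=\{x:h(x)\ge0\}$; and $\tilde b_{ij}(x)=b_{ij}+\alpha h(x)$. Data: $\mathcal D=(\xi_t)_{t\in[D]}$ is a dataset of $D$ samples drawn independently from $\mathbb{P}_\xi$ (and independent of the disturbances driving the system); its law is the product measure $\mathbb{P}_\xi^{D}$, and $\operatorname{supp}(\mathcal D)$ is the support of this law, i.e. the intersection of the closures of all sets of probability one. A data-dependent control law $\kappa_{\mathcal D}$ is a feedback law that depends (measurably) on $\mathcal D$. Set $Z^{ij}_t=c_{ij}^\top\xi_t$, $t\in[D]$, and let $Z^{ij}_{(1)}\le\dots\le Z^{ij}_{(D)}$ be the order statistics of $(Z^{ij}_t)_{t\in[D]}$.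 $F_{\mathrm b}^{-1}(\gamma;D,\delta)$ denotes the $\gamma$-quantile of the binomial distribution with $D$ trials and success probability $\delta$, i.e. the smallest integer $t$ with $\mathbb{P}\{\mathrm{Bin}(D,\delta)\le t\}\ge\gamma$; under the stated bound on $D$, $\tau_i\in[D]$. For a fixed realization of $\mathcal D$, $P_N(x;\kappa_{\mathcal D})=\mathbb{P}\{\exists k\in[N]:x_k\notin S\}$ is the $N$-step exit probability of the system started at $x_0=x$ with $u_k=\kappa_{\mathcal D}(x_k)$; the outer probability $\mathbb{P}_\xi^{D}$ is over $\mathcal D$. *)

(* Defs.v *)
From HB Require Import structures.
From mathcomp Require Import all_boot all_order all_algebra.
From mathcomp Require Import all_classical all_reals all_analysis.

Set Implicit Arguments.
Unset Strict Implicit.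
Unset Printing Implicit Defensive.

Import Order.TTheory GRing.Theory Num.Theory.
Import numFieldNormedType.Exports.

Local Open Scope classical_set_scope.
Local Open Scope ring_scope.

(* Vectors of R^n are columns 'cV[R]_n; a dataset of D samples in R^n is a
   matrix 'M[R]_(n, D) whose t-th column is the t-th sample.  Both carry the
   Borel sigma-algebra of the product topology on matrices. *)
HB.instance Definition _ (R : realType) (m n : nat) :=
  @isMeasurable.Build (sigma_display (@open 'M[R]_(m, n))) 'M[R]_(m, n)
    <<s @open 'M[R]_(m, n) >> (@sigma_algebra0 _ setT _)
    (@sigma_algebraC 'M[R]_(m, n) _) (@sigma_algebra_bigcup _ setT _).

Section Finite_extrema.
Variables (R : realType) (k : nat) (k0 : (0 < k)%N) (F : 'I_k -> R).

Definition fin_min : R := \big[Num.min/F (Ordinal k0)]_(i < k) F i.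
Definition fin_max : R := \big[Num.max/F (Ordinal k0)]_(i < k) F i.

End Finite_extrema.

Definition dotv (R : realType) (n : nat) (c x : 'cV[R]_n) : R :=
  (c^T *m x) ord0 ord0.

Section Safe_set.
Variables (R : realType) (n nP : nat) (m : 'I_nP -> nat).
Variables (nP0 : (0 < nP)%N) (m0 : forall i, (0 < m i)%N).
Variables (c : forall i, 'I_(m i) -> 'cV[R]_n) (b : forall i, 'I_(m i) -> R).

Definition hpiece (i : 'I_nP) (x : 'cV[R]_n) : R :=
  fin_max (m0 i) (fun j => dotv (c j) x - b j).

Definition hfun (x : 'cV[R]_n) : R := fin_min nP0 (fun i => hpiece i x).

Definition safe_set : set 'cV[R]_n := [set x | 0 <= hfun x].

Definition btilde (alpha : R) (i : 'I_nP) (j : 'I_(m i)) (x : 'cV[R]_n) : R :=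
  b j + alpha * hfun x.

End Safe_set.

Section Closed_loop.
Variables (R : realType) (n nu : nat).
Variables (f : 'cV[R]_n -> 'cV[R]_nu -> 'cV[R]_n).
Variables (kap : 'cV[R]_n -> 'cV[R]_nu).

Fixpoint trajectory (w : nat -> 'cV[R]_n) (x : 'cV[R]_n) (k : nat)
    : 'cV[R]_n :=
  if k is k'.+1 then
    let y := trajectory w x k' in f y (kap y) + w k'
  else x.

Definition exit_prob d (Omega : measurableType d) (P : probability Omega R)
    (xi : nat -> Omega -> 'cV[R]_n) (S : set 'cV[R]_n) (N : nat)
    (x : 'cV[R]_n) : \bar R :=
  P [set w | exists k, (1 <= k <= N)%N /\ ~ S (trajectory (xi ^~ w) x k)].

End Closed_loop.

(* Laws are compared on measurable sets only: a measure of the library is also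
   defined, with no meaning, on the other sets. *)
Definition iid_with_law (R : realType) d d' (Omega : measurableType d)
    (T : measurableType d') (P : probability Omega R) (mu : probability T R)
    (X : nat -> Omega -> T) : Prop :=
  [/\ forall k, measurable_fun [set: Omega] (X k),
      forall k A, measurable A -> P (X k @^-1` A) = mu A &
      forall (J : seq nat) (A : nat -> set T), uniq J ->
        (forall k, measurable (A k)) ->
        P [set w | forall k, k \in J -> A k (X k w)] =
        (\prod_(k <- J) P (X k @^-1` A k))%E].

(* The product measure is the unique probability measure with this property. *)
Definition is_product_measure (R : realType) (n D : nat)
    (mu : probability 'cV[R]_n R) (muD : probability 'M[R]_(n, D) R) : Prop :=
  forall A : 'I_D -> set 'cV[R]_n, (forall t, measurable (A t)) ->
    muD [set d | forall t, A t (col t d)] = (\prod_(t < D) mu (A t))%E.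

Definition law_support (R : realType) (m n : nat)
    (mu : probability 'M[R]_(m, n) R) : set 'M[R]_(m, n) :=
  \bigcap_(A in [set A | measurable A /\ mu A = 1%E]) closure A.

(* The k-th smallest value, k being counted from 1. *)
Definition order_stat (R : realType) (D : nat) (Z : 'I_D -> R) (k : nat) : R :=
  nth 0 (sort <=%R [seq Z t | t <- enum 'I_D]) k.-1.

(* The default value 0 is irrelevant: the set is a singleton when gamma <= 1. *)
Definition binomial_quantile (R : realType) (gamma : R) (D : nat) (delta : R)
    : nat :=
  let reached t := (gamma%:E <= binomial_prob D delta [set k | (k <= t)%N])%E in
  xget 0%N [set t | reached t /\ forall s, reached s -> (t <= s)%N].

(* Main.v *)
(* Fix i, j and let q be a delta^(i)-quantile of c_ij^T xi.  The order statistic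
   Z_(tau_i) can exceed q only if fewer than tau_i of the D samples fall at or
   below q; the number of those samples is binomial with success probability at
   least delta^(i), so by minimality of tau_i this has probability less than
   gamma / n_tot.  By a union bound over (i, j), with probability at least
   1 - gamma every event {c_ij^T xi < Z_(tau_i)} has probability at most
   delta / n_P.  For such a dataset, another union bound over i shows that each
   step stays in S with probability at least 1 - delta, whatever indices j_i the
   current state selects, and independence of the noise gives
   (1 - delta)^N >= 1 - eps over N steps.

   A measure is only meaningful on measurable sets, so the set of good datasets
   has to be measurable: this follows from Fubini's theorem, since the exit
   event is jointly measurable in the dataset and the noise, the Borel sets of
   matrices being generated by the coordinates. *)
Require Import Defs.
From HB Require Import structures.
From mathcomp Require Import all_boot all_order all_algebra.
From mathcomp Require Import all_classical all_reals all_analysis.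
From mathcomp Require Import measurable_realfun.
From mathcomp Require Import lra.

Set Implicit Arguments.
Unset Strict Implicit.
Unset Printing Implicit Defensive.

Import Order.TTheory GRing.Theory Num.Theory.
Import numFieldNormedType.Exports.

Local Open Scope classical_set_scope.
Local Open Scope ring_scope.

(** * Borel sets of matrices and the support of a law *)

Section matrix_borel.
Variables (R : realType) (m n : nat).
Implicit Types M : 'M[R]_(m, n).

Definition rat_box (q : 'M[(rat * rat)%type]_(m, n)) : set 'M[R]_(m, n) :=
  [set M | forall i j, ratr (q i j).1 < M i j < ratr (q i j).2].

(** A neighbourhood contains a product of entrywise neighbourhoods, each of which shrinks to an
    interval with rational ends. Rational ends keep the family of boxes countable. *)
Lemma nbhs_rat_box M (A : set 'M[R]_(m, n)) :
  nbhs M A -> exists q, rat_box q M /\ rat_box q `<=` A.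
Proof.
move=> [P MP PA].
have /choice[q qP] (ij : 'I_m * 'I_n) : exists q : rat * rat,
    (ratr q.1 < M ij.1 ij.2 < ratr q.2) /\
    [set x : R | ratr q.1 < x < ratr q.2] `<=` P ij.1 ij.2.
  have /nbhs_ballP[e /= e0 eP] := MP ij.1 ij.2.
  set x := M ij.1 ij.2 in eP *.
  have [|a xa] := @rat_in_itvoo R (x - e) x; first by rewrite ltrBlDr ltrDl.
  have [|b xb] := @rat_in_itvoo R x (x + e); first by rewrite ltrDl.
  move: xa xb; rewrite !in_itv/= => /andP[xa ax] /andP[xb bx].
  exists (a, b); split => /=; first by rewrite ax xb.
  move=> y /= /andP[ay yb]; apply: eP; rewrite /ball/= ltr_distlC.
  by rewrite (lt_trans xa ay) (lt_trans yb bx).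
exists (\matrix_(i, j) q (i, j)); split=> [i j|N qN].
  by rewrite mxE; have [] := qP (i, j).
apply: PA => i j; have [_] := qP (i, j); apply => /=.
by have := qN i j; rewrite mxE.
Qed.

Lemma rat_boxE q : rat_box q = \bigcap_(ij : 'I_m * 'I_n)
    (fun M => M ij.1 ij.2) @^-1` `]ratr (q ij.1 ij.2).1, ratr (q ij.1 ij.2).2[.
Proof.
apply/seteqP; split => [x qx [i j] _ /=|x qx i j].
  by rewrite in_itv/=; exact: qx.
by have := qx (i, j) Logic.I; rewrite /= in_itv.
Qed.

Lemma measurable_coord i j :
  measurable_fun [set: 'M[R]_(m, n)] (fun M => M i j).
Proof.
apply: (measurability _ (RGenOpens.measurableE R)).
move=> _ [_ [a [b ->] <-]]; rewrite setTI; apply: sub_sigma_algebra.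
apply: open_comp => [M _|]; first exact: coord_continuous.
exact: interval_open.
Qed.

(** An open set is the union of the countably many rational boxes inside it, and the preimage of a
    box is a finite intersection of conditions on single entries. *)
Lemma measurable_fun_mx d (T : measurableType d) (g : T -> 'M[R]_(m, n)) :
  (forall i j, measurable_fun [set: T] (fun x => g x i j)) ->
  measurable_fun [set: T] g.
Proof.
move=> mg; apply: (@measurability _ _ _ _ _ _ (@open 'M[R]_(m, n))) => //.
move=> _ [V openV <-]; rewrite setTI.
have -> : g @^-1` V =
    \bigcup_q (if `[< rat_box q `<=` V >] then g @^-1` rat_box q else set0).
  apply/seteqP; split => [x Vx|x [q _]].
    have [|q [qx qV]] := @nbhs_rat_box (g x) V; first exact: open_nbhs_nbhs.
    by exists q => //; rewrite asboolT.
  by case: asboolP => // + qx; apply.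
apply: countable_bigcupT_measurable => [|q]; first exact: countableP.
case: asboolP => // _.
rewrite rat_boxE preimage_bigcap.
apply: fin_bigcap_measurable => // ij _.
by rewrite -[X in measurable X]setTI; rewrite -comp_preimage; exact: mg.
Qed.

Lemma measurable_rat_box q : measurable (rat_box q).
Proof.
rewrite rat_boxE; apply: fin_bigcap_measurable => // ij _.
by rewrite -[X in measurable X]setTI; exact: measurable_coord.
Qed.

Lemma open_mx_measurable (A : set 'M[R]_(m, n)) : open A -> measurable A.
Proof. exact: sub_sigma_algebra. Qed.

Lemma closed_mx_measurable (A : set 'M[R]_(m, n)) : closed A -> measurable A.
Proof. by move/closed_openC/open_mx_measurable/measurableC; rewrite setCK. Qed.

(** The support is an uncountable intersection, so its full measure is not immediate. Every
    neighbourhood of a point that avoids the countably many null boxes has a box of positive measure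
    around the point, and this box meets every set of measure one. *)
Lemma law_support_full (mu : probability 'M[R]_(m, n) R) :
  exists A, [/\ measurable A, mu A = 1%E & A `<=` law_support mu].
Proof.
pose null q := if mu (rat_box q) == 0%E then rat_box q else set0.
have mnull q : measurable (null q).
  by rewrite /null; case: ifP => // _; exact: measurable_rat_box.
have mN : measurable (\bigcup_q null q).
  by apply: countable_bigcupT_measurable => //; exact: countableP.
have N0 : mu (\bigcup_q null q) = 0%E.
  (* Countable subadditivity is stated for sequences. The value given to integers that code no box
     is harmless, since every [null q] has measure 0. *)
  have [p pP] : exists p : nat -> 'M[(rat * rat)%type]_(m, n), forall q,
      exists k, p k = q.
    exists (fun k => odflt (const_mx (0, 0)) (unpickle k)) => q.
    by exists (pickle q); rewrite pickleK.
  apply/eqP; rewrite -measure_le0.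
  have -> : \bigcup_q null q = \bigcup_k null (p k).
    apply/seteqP; split=> x [q _ qx]; last by exists (p q).
    by have [k pk] := pP q; exists k => //; rewrite pk.
  apply: le_trans (generalized_Boole_inequality _ _ _) _ => //.
    exact: bigcupT_measurable.
  rewrite eseries0// => k _ _.
  by rewrite /null; case: ifP => [/eqP|] //; rewrite measure0.
exists (~` \bigcup_q null q); split; first exact: measurableC.
  by rewrite probability_setC// N0 sube0.
move=> M NM A [mA A1] B /nbhs_rat_box[q [qM qB]].
apply: contrapT => AB0; apply: NM; exists q => //; rewrite /null ifT//.
rewrite -measure_le0 -[leRHS](_ : mu (~` A) = _).
  apply: le_measure; rewrite ?inE; [exact: measurable_rat_box|
    exact: measurableC|].
  by move=> N qN AN; apply: AB0; exists N; split => //; exact: qB.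
by rewrite probability_setC// A1 subee.
Qed.

End matrix_borel.

(** * Law of a random variable restricted to an event *)

Section law_on.
Context (R : realType) d d' (Omega : measurableType d) (T : measurableType d').
Variables (P : probability Omega R) (E : set Omega) (X : Omega -> T).

(* The proofs are arguments so that the measure structure can be inferred. *)
Definition law_on (mE : measurable E) (mX : measurable_fun [set: Omega] X)
  (A : set T) : \bar R := P (E `&` X @^-1` A).

Variables (mE : measurable E) (mX : measurable_fun [set: Omega] X).
Local Notation law := (law_on mE mX).

Let measurable_preX A : measurable A -> measurable (X @^-1` A).
Proof. by move=> mA; rewrite -[X in measurable X]setTI; exact: mX. Qed.

Let law_on0 : law set0 = 0%E.
Proof. by rewrite /law_on preimage_set0 setI0 measure0. Qed.

Let law_on_ge0 A : (0 <= law A)%E.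
Proof. exact: measure_ge0. Qed.

Let law_on_additive : semi_sigma_additive law.
Proof.
move=> F mF tF mUF; rewrite /law_on preimage_bigcup setI_bigcupr.
apply: measure_semi_sigma_additive.
- by move=> k; apply: measurableI => //; exact: measurable_preX.
- apply/trivIsetP => /= i j _ _ ij; rewrite setIACA -preimage_setI.
  by move/trivIsetP : tF => /(_ _ _ _ _ ij) ->//; rewrite preimage_set0 setI0.
- rewrite -setI_bigcupr -preimage_bigcup.
  by apply: measurableI => //; exact: measurable_preX.
Qed.

HB.instance Definition _ :=
  isMeasure.Build _ _ _ law law_on0 law_on_ge0 law_on_additive.

Let law_on_fin : fin_num_fun law.
Proof.
move=> A mA; apply: fin_num_measure; apply: measurableI => //.
exact: measurable_preX.
Qed.

HB.instance Definition _ := Measure_isFinite.Build _ _ _ law law_on_fin.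

End law_on.

(** * Probability that a noise-driven process stays in a set *)

Section stay.
Context (R : realType) d d' d'' (Omega : measurableType d)
  (T : measurableType d') (X : measurableType d'').
Variables (P : probability Omega R) (mu : probability T R).
Variables (xi : nat -> Omega -> T) (xi_iid : iid_with_law P mu xi).
Variables (step : X * T -> X) (mstep : measurable_fun [set: X * T] step).
Variables (S : set X) (mS : measurable S).
Variables (x : nat -> Omega -> X) (x0 : X).
Hypotheses (xE0 : x 0 = cst x0)
  (xES : forall k, x k.+1 = fun w => step (x k w, xi k w)).

Definition stay k : set Omega := [set w | forall l, (l <= k)%N -> S (x l w)].

Definition noise_rect (J : seq nat) (A : nat -> set T) : set Omega :=
  [set w | forall k, k \in J -> A k (xi k w)].

Let mxi k : measurable_fun [set: Omega] (xi k).
Proof. by case: xi_iid. Qed.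

Let xi_law k A : measurable A -> P (xi k @^-1` A) = mu A.
Proof. by case: xi_iid => _ + _; exact. Qed.

Let mx k : measurable_fun [set: Omega] (x k).
Proof.
elim: k => [|k IH]; first by rewrite xE0; exact: measurable_cst.
by rewrite xES; apply: measurableT_comp => //; exact: measurable_fun_pair.
Qed.

Let mpre d1 d2 (U : measurableType d1) (V : measurableType d2) (g : U -> V) B :
  measurable_fun [set: U] g -> measurable B -> measurable (g @^-1` B).
Proof. by move=> mg mB; rewrite -[X in measurable X]setTI; exact: mg. Qed.

Lemma measurable_stay k : measurable (stay k).
Proof.
have -> : stay k = \bigcap_(l in `I_k.+1) (x l @^-1` S).
  by apply/seteqP; split=> w h l; exact: h.
by apply: fin_bigcap_measurable => // l _; exact: mpre.
Qed.

Lemma measurable_noise_rect J A :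
  (forall k, measurable (A k)) -> measurable (noise_rect J A).
Proof.
move=> mA.
have -> : noise_rect J A = \bigcap_(k in [set` J]) (xi k @^-1` A k).
  by apply/seteqP; split=> w h l; exact: h.
by apply: fin_bigcap_measurable => // l _; exact: mpre.
Qed.

Lemma stayS k : stay k.+1 = stay k `&` x k.+1 @^-1` S.
Proof.
apply/seteqP; split=> w.
  by move=> h; split=> [l lk|]; apply: h => //; exact: leqW.
by move=> [h hk] l; rewrite leq_eqVlt => /predU1P[->//|/h].
Qed.

Lemma noise_rect1 k B : xi k @^-1` B = noise_rect [:: k] (fun=> B).
Proof.
by apply/seteqP; split=> w h; [move=> j; rewrite inE => /eqP->|exact/h/mem_head].
Qed.

(** Since [k] is new to [J], overriding [A] at [k] leaves the other constraints untouched and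
    independence splits off the factor of [xi k]. The set equality lets an induction treat the
    enlarged event as a rectangle again. *)
Lemma noise_rect_cons k J A B :
  k \notin J -> uniq J -> (forall j, measurable (A j)) -> measurable B ->
  P (noise_rect J A `&` xi k @^-1` B) = (P (noise_rect J A) * mu B)%E
  /\ noise_rect J A `&` xi k @^-1` B =
     noise_rect (k :: J) (fun j => if j == k then B else A j).
Proof.
move=> kJ uJ mA mB.
have eqR : noise_rect J A `&` xi k @^-1` B =
    noise_rect (k :: J) (fun j => if j == k then B else A j).
  apply/seteqP; split=> w.
    move=> [JA kB] j; rewrite inE.
    by case: eqVneq => [->//|jk /= jJ]; exact: JA.
  move=> h; split; last by have := h k; rewrite inE eqxx; exact.
  move=> j jJ; have := h j; rewrite inE jJ orbT => /(_ erefl).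
  by case: eqVneq => // jk; rewrite -jk jJ in kJ.
split=> //; rewrite eqR; have [_ _ xi_indep] := xi_iid.
rewrite xi_indep//=; last 2 first.
- by rewrite kJ.
- by move=> j; case: ifP.
rewrite xi_indep// big_cons eqxx xi_law// muleC; congr (_ * _)%E.
apply: eq_big_seq => j jJ; case: eqVneq => // jk.
by rewrite -jk jJ in kJ.
Qed.

(* Independence from all future noises at once is what makes the induction go
   through: the noise absorbed by a step is moved from the state to [J]. *)
Lemma stay_indep k : forall B J A, measurable B -> uniq J ->
  (forall j, j \in J -> (k <= j)%N) -> (forall j, measurable (A j)) ->
  P (stay k `&` x k @^-1` B `&` noise_rect J A) =
  (P (stay k `&` x k @^-1` B) * P (noise_rect J A))%E.
Proof.
elim: k => [|k IH] B J A mB uJ Jk mA.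
  have : stay 0 `&` x 0 @^-1` B = setT \/ stay 0 `&` x 0 @^-1` B = set0.
    rewrite /stay xE0; have [[Sx Bx]|nSB] := pselect (S x0 /\ B x0).
      left; apply/seteqP; split=> // w _; split=> // l.
      by rewrite leqn0 => /eqP->; rewrite xE0.
    right; apply/seteqP; split=> // w [/(_ 0%N (leqnn _))].
    by rewrite xE0 /= => ? ?; apply: nSB.
  by case=> ->; rewrite ?setTI ?probability_setT ?mul1e// set0I measure0 mul0e.
have mE := measurable_stay k; have mN := measurable_noise_rect J mA.
have mp : measurable_fun [set: Omega] (fun w => (x k w, xi k w)).
  exact: measurable_fun_pair.
have kJ : k \notin J by apply/negP => /Jk; rewrite ltnn.
pose C := step @^-1` (S `&` B).
(* The condition on [x k.+1] is read as a condition on the pair [(x k, xi k)]. *)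
have mC : measurable C by apply: mpre => //; exact: measurableI.
have -> : stay k.+1 `&` x k.+1 @^-1` B =
    stay k `&` (fun w => (x k w, xi k w)) @^-1` C.
  by rewrite stayS -setIA -preimage_setI xES.
have Npos : (0 <= fine (P (noise_rect J A)))%R by exact: fine_ge0.
have mEN := measurableI _ _ mE mN.
(* Two measures on pairs are compared: the law of [(x k, xi k)] on [stay k] intersected with the
   noise rectangle, and [m'], its law on [stay k] alone scaled by the probability of that rectangle.
   On measurable rectangles both agree with one product measure, so they are equal. *)
pose m' := mscale (NngNum Npos) (law_on P mE mp).
rewrite setIAC.
have PN : P (noise_rect J A) = (fine (P (noise_rect J A)))%:E.
  by rewrite fineK// fin_num_measure.
have -> : P (stay k `&` noise_rect J A `&`
    (fun w => (x k w, xi k w)) @^-1` C) = law_on P mEN mp C by [].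
rewrite muleC [in RHS]PN -[RHS]/(m' C).
have lJ j : j \in J -> (k <= j)%N by move/Jk/ltnW.
have IHN B1 : measurable B1 -> law_on P mEN (mx k) B1 =
    (P (stay k `&` x k @^-1` B1) * P (noise_rect J A))%E.
  by move=> mB1; rewrite /law_on setIAC IH.
rewrite -(@product_measure_unique _ _ _ _ _ (law_on P mEN (mx k)) mu)//.
  apply: product_measure_unique => // B1 B2 mB1 mB2.
  rewrite [X in (X * _)%E]IHN// -[LHS]/(_%:E * P _)%E -PN /law_on.
  rewrite -[X in (_ * P (_ `&` X))%E]/(x k @^-1` B1 `&` xi k @^-1` B2) setIA.
  (* The noise [xi k] drives the step out of [x k], hence counts as future noise at time [k]. *)
  rewrite noise_rect1 IH//; last by move=> j; rewrite inE => /eqP->.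
  by rewrite -noise_rect1 xi_law// muleA; congr (_ * _)%E; exact: muleC.
move=> B1 B2 mB1 mB2; rewrite [X in (X * _)%E]IHN//.
rewrite -[LHS]/(P (_ `&` (x k @^-1` B1 `&` xi k @^-1` B2))).
have [PNk eqR] := noise_rect_cons kJ uJ mA mB2.
have -> : stay k `&` noise_rect J A `&` (x k @^-1` B1 `&` xi k @^-1` B2) =
    stay k `&` x k @^-1` B1 `&` (noise_rect J A `&` xi k @^-1` B2).
  by rewrite setIACA.
rewrite -muleA -PNk eqR IH//=.
- by rewrite kJ.
- by move=> j; rewrite inE => /predU1P[->//|/lJ].
- by move=> j; case: ifP.
Qed.

(** On [stay k] the state is in [S] and independent of [xi k], so Fubini writes the probability of
    [stay k.+1] as an integral, against the law of [x k] on [stay k], of one-step probabilities that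
    are at least [a] on [S]. Each step thus costs a factor [a]. *)
Lemma stay_prob (a : R) N : S x0 -> 0 <= a ->
  (forall y, S y -> a%:E <= mu [set z | S (step (y, z))])%E ->
  ((a ^+ N)%:E <= P (stay N))%E.
Proof.
move=> Sx0 a0 aP; elim: N => [|k IH].
  rewrite expr0 (_ : stay 0 = setT) ?probability_setT//.
  apply/seteqP; split=> // w _ l.
  by rewrite leqn0 => /eqP->; rewrite xE0.
have mE := measurable_stay k.
have mp : measurable_fun [set: Omega] (fun w => (x k w, xi k w)).
  exact: measurable_fun_pair.
pose C := step @^-1` S; have mC : measurable C by exact: mpre.
have -> : P (stay k.+1) = law_on P mE mp C by rewrite stayS xES.
rewrite -(@product_measure_unique _ _ _ _ _ (law_on P mE (mx k)) mu)//; last first.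
  move=> B1 B2 mB1 mB2; rewrite /law_on.
  rewrite -[LHS]/(P (_ `&` (x k @^-1` B1 `&` xi k @^-1` B2))) setIA.
  rewrite noise_rect1 stay_indep//; last by move=> j; rewrite inE => /eqP->.
  by rewrite -noise_rect1 xi_law.
have mxs := measurable_fun_xsection mu mC.
(* The law of [x k] on [stay k] gives [S] the mass of [stay k], so integrating the constant [a]
   yields the induction hypothesis times [a]. *)
apply: (@le_trans _ _ (\int[law_on P mE (mx k)]_(y in S) cst a%:E y)%E).
  rewrite integral_cst// exprS EFinM lee_wpmul2l ?lee_fin//.
  rewrite -[leRHS]/(P (stay k `&` x k @^-1` S)) (_ : _ `&` _ = stay k)//.
  by apply/seteqP; split=> [w []//|w h]; split=> //; exact: h.
apply: (@le_trans _ _ (\int[law_on P mE (mx k)]_(y in S) mu (xsection C y))%E).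
  apply: ge0_le_integral => //.
  - exact: measurable_funTS.
  - move=> y Sy; apply: le_trans (aP y Sy) _.
    rewrite le_eqVlt; apply/orP; left; apply/eqP; congr (mu _).
    by apply/seteqP; split=> z; rewrite /xsection /= inE.
by apply: ge0_subset_integral.
Qed.

End stay.

(** * Binomial lower tails, their quantiles, and order statistics *)

Section binomial_lt.
Variable R : realType.
Implicit Types (p q : R) (n k : nat).

(** The tail is strict because minimality of the quantile bounds the probability of strictly fewer
    successes than the quantile. *)
Definition binomial_lt n k p : R := \sum_(j < k) binomial_pmf n p j.

Lemma binomial_pmfS0 n p : binomial_pmf n.+1 p 0 = (1 - p) * binomial_pmf n p 0.
Proof. by rewrite /binomial_pmf !subn0 !expr0 !mul1r !bin0 !mulr1n exprS. Qed.

Lemma binomial_pmfSS n p k : binomial_pmf n.+1 p k.+1 =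
  p * binomial_pmf n p k + (1 - p) * binomial_pmf n p k.+1.
Proof.
rewrite /binomial_pmf binS subSS mulrnDr [LHS]addrC; congr (_ + _).
  by rewrite mulrnAr exprS mulrA.
have [kn|nk] := ltnP k n; last by rewrite bin_small// !mulr0n mulr0.
by rewrite -(subnSK kn) [X in _ * X *+ _ = _]exprS mulrnAr mulrCA.
Qed.

(** Conditioning on one trial: after a success fewer than [k] further successes are allowed, after a
    failure fewer than [k.+1]. *)
Lemma binomial_ltSS n k p : binomial_lt n.+1 k.+1 p =
  p * binomial_lt n k p + (1 - p) * binomial_lt n k.+1 p.
Proof.
rewrite /binomial_lt !big_ord_recl/= binomial_pmfS0 mulrDr addrCA; congr (_ + _).
rewrite !mulr_sumr -big_split/=; apply: eq_bigr => i _.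
by rewrite binomial_pmfSS.
Qed.

Lemma binomial_lt0 k p : binomial_lt 0 k p = (0 < k)%N%:R.
Proof.
rewrite /binomial_lt; case: k => [|k]; first by rewrite big_ord0.
rewrite big_ord_recl big1 ?addr0.
  by rewrite /binomial_pmf subn0 !expr0 mulr1 bin0.
by move=> i _; rewrite /binomial_pmf bin_small.
Qed.

Lemma binomial_lt_full n p : binomial_lt n n.+1 p = 1.
Proof.
rewrite /binomial_lt -[RHS](expr1n _ n) -[in RHS](subrK p 1) exprDn.
by apply: eq_bigr => i _; rewrite /binomial_pmf mulrC.
Qed.

Lemma binomial_lt_homo n k p : 0 <= p <= 1 ->
  binomial_lt n k p <= binomial_lt n k.+1 p.
Proof.
by move=> p01; rewrite /binomial_lt big_ord_recr/= lerDl binomial_pmf_ge0.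
Qed.

(** In the one-trial recursion, the induction hypothesis replaces [q] by [p] inside both tails. The
    weights are handled next: a larger success probability puts more weight on the smaller tail. *)
Lemma binomial_lt_anti n k p q : 0 <= p -> p <= q -> q <= 1 ->
  binomial_lt n k q <= binomial_lt n k p.
Proof.
move=> p0 pq q1; elim: n k => [|n IH] [|k]; rewrite ?binomial_lt0//.
  by rewrite /binomial_lt !big_ord0.
have p01 : 0 <= p <= 1 by rewrite p0 (le_trans pq).
rewrite !binomial_ltSS.
apply: (@le_trans _ _ (q * binomial_lt n k p + (1 - q) * binomial_lt n k.+1 p)).
  by rewrite lerD// ler_wpM2l ?subr_ge0// (le_trans p0).
by have := binomial_lt_homo n k p01; nra.
Qed.

Lemma binomial_probE n k p : 0 <= p <= 1 ->
  binomial_prob n p [set j | (j <= k)%N] = (binomial_lt n k.+1 p)%:E.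
Proof.
move=> p01; rewrite /binomial_prob p01.
rewrite (_ : [set j | (j <= k)%N] = `I_k.+1)//.
rewrite esum_fset//; last by move=> i _; rewrite lee_fin binomial_pmf_ge0.
by rewrite -fsbig_ord/= sumEFin.
Qed.

(** Zero successes have probability [(1 - p) ^+ n], which is below [gamma], so the quantile is
    positive. Its predecessor then fails to reach [gamma] by minimality. *)
Lemma binomial_quantileP gamma n p : 0 < p < 1 -> gamma < 1 ->
  (1 - p) ^+ n < gamma ->
  (0 < binomial_quantile gamma n p)%N /\
  binomial_lt n (binomial_quantile gamma n p) p < gamma.
Proof.
move=> /andP[p0 p1] g1 Dg; have p01 : 0 <= p <= 1 by rewrite !ltW.
rewrite /binomial_quantile.
set Q := (X in xget _ X).
have : Q (xget 0%N Q).
  apply: xgetPex.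
  pose reached t := (gamma%:E <= binomial_prob n p [set k | (k <= t)%N])%E.
  (* The tail up to [n] is 1, so the set is inhabited and [xget] does not fall back on its
     default. *)
  have Rn : exists t, reached t.
    by exists n; rewrite /reached binomial_probE// lee_fin binomial_lt_full ltW.
  by exists (ex_minn Rn); case: ex_minnP.
case: (xget 0%N Q) => [|t] [rt tmin].
  move: rt; rewrite binomial_probE// lee_fin /binomial_lt big_ord1.
  rewrite /binomial_pmf subn0 expr0 mul1r bin0 mulr1n => /(lt_le_trans Dg).
  by rewrite ltxx.
split=> //; rewrite ltNge; apply/negP => gt; have := tmin t.
by rewrite binomial_probE// lee_fin gt ltnn => /(_ isT).
Qed.

End binomial_lt.

(** Ranks start at 1, so the [k]-th value sits at position [k.-1] of the sorted list; all entries
    from there on exceed [q], leaving at most [k.-1] others. When [k] exceeds [D], [nth] returns its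
    default 0, but no entry remains from that position on and the count is still right. *)
Lemma order_stat_gt (R : realType) D (Z : 'I_D -> R) k (q : R) : (0 < k)%N ->
  q < order_stat Z k -> (#|[pred t | (Z t <= q)%R]| < k)%N.
Proof.
move=> k0; rewrite /order_stat; set s := sort _ _ => qs.
have ss : sorted <=%R s by apply: sort_le_sorted.
have -> : #|[pred t | (Z t <= q)%R]| = count (fun y => y <= q) s.
  rewrite /s (permP (permEl (perm_sort _ _))) count_map cardE size_filter.
  by rewrite -enumT; apply: eq_count => t; rewrite /= inE.
rewrite -(cat_take_drop k.-1 s) count_cat.
have -> : count (fun y => y <= q) (drop k.-1 s) = 0%N.
  apply/eqP; rewrite -leqn0 leqNgt -has_count; apply/hasPn => y.
  move=> /(nthP 0)[i]; rewrite size_drop nth_drop => ilt <-.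
  rewrite -ltNge (lt_le_trans qs)// (sorted_leq_nth le_trans lexx)//.
  - by rewrite inE -subn_gt0 (leq_ltn_trans _ ilt).
  - by rewrite inE -ltn_subRL.
  - by rewrite leq_addr.
rewrite addn0 (leq_ltn_trans (count_size _ _))// size_take_min.
by rewrite -[ltnRHS]prednK// ltnS geq_minl.
Qed.

(** * Union bound over a finite family *)

Section finite_boole.
Context (R : realType) d (T : measurableType d) (mu : {measure set T -> \bar R}).

Lemma measure_finite_cover (I : finType) (Q : pred I) (F : I -> set T) A :
  measurable A -> (forall i, Q i -> measurable (F i)) ->
  (forall x, A x -> exists2 i, Q i & F i x) ->
  (mu A <= \sum_(i | Q i) mu (F i))%E.
Proof.
move=> mA mF AF.
(* Recording the index as a list member allows an induction on the list that removes one [F i] from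
   [A] at a time. *)
have {AF} : forall x, A x -> exists2 i, i \in index_enum I & Q i /\ F i x.
  by move=> x /AF[i Qi Fix]; exists i => //; rewrite mem_index_enum.
elim: (index_enum I) A mA => [|i r IH] A mA AF.
  rewrite big_nil (_ : A = set0) ?measure0// -subset0 => x /AF[i].
  by rewrite in_nil.
rewrite big_cons; case: ifPn => [Qi|nQi]; last first.
  apply: IH => // x /AF[j]; rewrite inE => /predU1P[->[]|jr jF].
    by rewrite (negbTE nQi).
  by exists j.
have mAF : measurable (A `\` F i) by apply: measurableD => //; exact: mF.
apply: (@le_trans _ _ (mu (F i) + mu (A `\` F i)))%E.
  apply: (@le_trans _ _ (mu (F i `|` A `\` F i))).
    apply: le_measure; rewrite ?inE//; first by apply: measurableU => //; exact: mF.
    by move=> x Ax; have [Fx|nFx] := pselect (F i x); [left|right].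
  by apply: measureU2 => //; exact: mF.
rewrite leeD2l//; apply: IH => // x [/AF[j]].
by rewrite inE => /predU1P[->[]//|jr jF _]; exists j.
Qed.

End finite_boole.

(** * Quantiles of a real random variable, atoms allowed *)

Section threshold.
Context (R : realType) d (T : measurableType d) (mu : probability T R).

(** Take for [q] the infimum of the levels where the distribution function reaches [delta]. Right
    continuity gives the bound at [q]. An atom at [q] is why the second clause uses a strict event:
    below [q] the distribution function is less than [delta], so its left limits up to [q] are at
    most [delta]. *)
Lemma exists_threshold (Y : T -> R) (delta : R) :
  measurable_fun [set: T] Y -> 0 < delta < 1 ->
  exists q, (delta%:E <= mu [set z | (Y z <= q)%R])%E /\
    forall y, (delta%:E < mu [set z | (Y z < y)%R])%E -> q < y.
Proof.
move=> mY /andP[d0 d1].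
pose X : {RV mu >-> R} := HB.pack Y (isMeasurableFun.Build _ _ _ _ Y mY).
have cdfE r : cdf X r = mu [set z | (Y z <= r)%R].
  by rewrite /cdf /distribution /pushforward; congr (mu _).
pose E := [set r | (delta%:E <= cdf X r)%E].
have cdf_mono r r' : r <= r' -> (cdf X r <= cdf X r')%E.
  exact: cdf_nondecreasing.
(* The limits 1 and 0 of the distribution function at the two infinities make [E] nonempty and
   bounded below. *)
have hE : has_inf E.
  split; apply: contrapT => nE.
    suff : (1%E <= delta%:E)%E by rewrite lee_fin leNgt d1.
    apply: cvge_le (@cvg_cdfy1 _ _ _ mu X); apply: nearW => r.
    by rewrite leNgt; apply/negP => rE; apply: nE; exists r; exact: ltW.
  suff : (delta%:E <= 0%E)%E by rewrite lee_fin leNgt d0.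
  apply: cvge_ge (@cvg_cdfNy0 _ _ _ mu X); apply: nearW => r.
  rewrite leNgt; apply/negP => rE; apply: nE; exists r => r' r'E.
  rewrite leNgt; apply/negP => /ltW/cdf_mono; rewrite leNgt => /negP; apply.
  exact: lt_le_trans rE r'E.
exists (inf E); split.
  rewrite -cdfE; apply: cvge_ge (@cdf_right_continuous _ _ _ mu X (inf E)).
  near=> r; have Er : 0 < r - inf E.
    by rewrite subr_gt0; near: r; exact: nbhs_right_gt.
  have [e eE] := inf_adherent Er hE; rewrite addrC subrK => er.
  by apply: le_trans eE _; exact/cdf_mono/ltW.
move=> y; rewrite ltNge => yd; rewrite ltNge; apply: contra yd => yq.
have my r : measurable [set z | (Y z <= r)%R].
  rewrite (_ : [set _ | _] = Y @^-1` `]-oo, r]).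
    by rewrite -[X in measurable X]setTI; exact: (mY measurableT).
  by apply/seteqP; split=> z; rewrite /= in_itv.
have -> : [set z | (Y z < y)%R] = \bigcup_k [set z | (Y z <= y - k.+1%:R^-1)%R].
  apply/seteqP; split=> z /=.
    by move=> /ltr_add_invr[k ky]; exists k => //=; rewrite lerBrDr ltW.
  by move=> [k _ /= /le_lt_trans]; apply; rewrite ltrBlDr ltrDl.
have cvg_y : mu [set z | (Y z <= y - k.+1%:R^-1)%R] @[k --> \oo] -->
    mu (\bigcup_k [set z | (Y z <= y - k.+1%:R^-1)%R]).
  apply: nondecreasing_cvg_mu => //; first exact: bigcupT_measurable.
  move=> i j ij; apply/subsetPset => z /= /le_trans; apply.
  by rewrite lerD2l lerN2 lef_pV2 ?posrE// ler_nat ltnS.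
apply: cvge_le cvg_y; apply: nearW => k; rewrite -cdfE leNgt.
apply/negP => /ltW kE; have := ge_inf hE.2 kE.
by rewrite leNgt (lt_le_trans _ yq)// ltrBlDr ltrDl.
Unshelve. all: by end_near. Qed.

End threshold.

(** * Number of samples that fall in a given set *)

Section pattern.
Context (R : realType) (n D : nat).
Variables (mu : probability 'cV[R]_n R) (muD : probability 'M[R]_(n, D) R).
Hypothesis muDP : is_product_measure mu muD.

Lemma measurable_col t : measurable_fun [set: 'M[R]_(n, D)] (col t).
Proof.
apply: measurable_fun_mx => i j.
rewrite (_ : (fun x => _) = fun M : 'M[R]_(n, D) => M i t).
  exact: measurable_coord.
by apply/funext => M; rewrite mxE.
Qed.

Lemma sum_card_lt (I : finType) (G : nat -> R) k :
  \sum_(s : {set I} | (#|s| < k)%N) G #|s| = \sum_(j < k) G j *+ 'C(#|I|, j).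
Proof.
elim: k => [|k IH]; first by rewrite big_ord0 big_pred0.
rewrite big_ord_recr/= -IH (bigID (fun s : {set I} => #|s| < k)%N)/=.
congr (_ + _).
  by apply: eq_bigl => s; rewrite ltnS; case: ltngtP.
rewrite (eq_bigl (fun s : {set I} => #|s| == k)); last first.
  by move=> s; rewrite ltnS -leqNgt eqn_leq.
rewrite (eq_bigr (fun=> G k)) => [|s /eqP->//].
by rewrite sumr_const -card_draws cardsE.
Qed.

Definition count_lt (A : set 'cV[R]_n) k : set 'M[R]_(n, D) :=
  [set d | (#|[pred t | col t d \in A]| < k)%N].

(** Prescribing for every column whether it lies in [A] gives a product set, the only kind of event
    on which [is_product_measure] speaks directly. *)
Definition pattern (A : set 'cV[R]_n) (s : {set 'I_D}) : set 'M[R]_(n, D) :=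
  [set d | forall t, (if t \in s then A else ~` A) (col t d)].

Lemma count_lt_pattern A k :
  count_lt A k = \bigcup_(s in [set s : {set 'I_D} | (#|s| < k)%N]) pattern A s.
Proof.
apply/seteqP; split=> d.
  move=> dk; exists (finset (fun t => col t d \in A)).
    by rewrite /= cardsE.
  move=> t; rewrite inE; case: ifPn; first by rewrite inE.
  by rewrite notin_setE.
move=> [s /= sk sd]; rewrite /count_lt/=.
rewrite (eq_card (B := mem s))// => t; rewrite inE.
have := sd t; case: ifPn => ts.
  by rewrite -inE => ->.
by rewrite /= -notin_setE => /negbTE.
Qed.

Lemma measurable_pattern A s : measurable A -> measurable (pattern A s).
Proof.
move=> mA.
have -> : pattern A s =
    \bigcap_t (col t @^-1` (if t \in s then A else ~` A)).
  by apply/seteqP; split=> [d h t _|d h t]; [exact: h|exact: (h t)].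
apply: fin_bigcap_measurable => // t _.
rewrite -[X in measurable X]setTI; apply: measurable_col => //.
by case: ifP => // _; exact: measurableC.
Qed.

Lemma measurable_count_lt A k : measurable A -> measurable (count_lt A k).
Proof.
move=> mA; rewrite count_lt_pattern.
by apply: fin_bigcup_measurable => // s _; exact: measurable_pattern.
Qed.

(** The event is covered by the patterns of fewer than [k] columns. Each has probability
    [p ^+ #|s| * (1 - p) ^+ (D - #|s|)], and grouping them by cardinality produces the binomial
    coefficients. *)
Lemma count_lt_prob A k : measurable A ->
  (muD (count_lt A k) <= (binomial_lt D k (fine (mu A)))%:E)%E.
Proof.
move=> mA; set p := fine (mu A).
have muA : mu A = p%:E by rewrite fineK// fin_num_measure.
have muAC : mu (~` A) = (1 - p)%:E by rewrite probability_setC// muA EFinB.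
apply: (@le_trans _ _
    (\sum_(s : {set 'I_D} | (#|s| < k)%N) muD (pattern A s))%E).
  apply: measure_finite_cover.
  - exact: measurable_count_lt.
  - by move=> s _; exact: measurable_pattern.
  - by rewrite count_lt_pattern => d [s sk ds]; exists s.
rewrite (eq_bigr (fun s : {set 'I_D} =>
    (p ^+ #|s| * (1 - p) ^+ (D - #|s|))%:E)); last first.
  move=> s _.
  have -> : muD (pattern A s) =
      (\prod_(t < D) mu (if t \in s then A else ~` A))%E.
    by apply: muDP => t; case: ifP => // _; exact: measurableC.
  rewrite (eq_bigr (fun t => (if t \in s then p else 1 - p)%:E)); last first.
    by move=> t _; case: ifP.
  rewrite prodEFin; congr EFin.
  rewrite (bigID (mem s))/= (eq_bigr (fun=> p)); last by move=> t ->.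
  rewrite [X in _ * X](eq_bigr (fun=> 1 - p)); last by move=> t /negbTE->.
  rewrite !prodr_const; congr (_ * _ ^+ _).
  have /(congr1 (subn^~ #|s|)) := cardC (mem s).
  by rewrite addKn => ->; congr (_ - _)%N; exact: card_ord.
rewrite sumEFin lee_fin /binomial_lt.
rewrite (sum_card_lt _ (fun j => p ^+ j * (1 - p) ^+ (D - j)) k).
by rewrite card_ord.
Qed.

End pattern.

(** * Finite extrema and measurability of the safe set *)

Section finite_extrema.
Variables (R : realType) (k : nat) (k0 : (0 < k)%N).

Lemma fin_min_ge (F : 'I_k -> R) a : (a <= fin_min k0 F) <-> forall i, a <= F i.
Proof.
rewrite /fin_min; split=> [aF i|aF]; last by apply: le_bigmin.
by apply: le_trans aF _; exact: bigmin_le.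
Qed.

Lemma fin_max_ge (F : 'I_k -> R) i : F i <= fin_max k0 F.
Proof. exact: le_bigmax. Qed.

Context d (T : measurableType d) (F : 'I_k -> T -> R).
Hypothesis mF : forall i, measurable_fun [set: T] (F i).

Lemma measurable_fin_min :
  measurable_fun [set: T] (fun x => fin_min k0 (fun i => F i x)).
Proof.
rewrite /fin_min; elim: (index_enum _) => [|i r IH].
  by under eq_fun do rewrite big_nil; exact: mF.
by under eq_fun do rewrite big_cons; exact: measurable_minr.
Qed.

Lemma measurable_fin_max :
  measurable_fun [set: T] (fun x => fin_max k0 (fun i => F i x)).
Proof.
rewrite /fin_max; elim: (index_enum _) => [|i r IH].
  by under eq_fun do rewrite big_nil; exact: mF.
by under eq_fun do rewrite big_cons; exact: measurable_maxr.
Qed.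

End finite_extrema.

Lemma measurable_dotv (R : realType) n (c : 'cV[R]_n) :
  measurable_fun [set: 'cV[R]_n] (dotv c).
Proof.
rewrite /dotv; under eq_fun do rewrite mxE.
apply: measurable_sum => i; under eq_fun do rewrite mxE.
by apply: measurable_funM => //; exact: measurable_coord.
Qed.

Lemma measurable_addmx (R : realType) d (T : measurableType d) m n
    (g h : T -> 'M[R]_(m, n)) :
  measurable_fun [set: T] g -> measurable_fun [set: T] h ->
  measurable_fun [set: T] (fun x => g x + h x).
Proof.
move=> mg mh; apply: measurable_fun_mx => i j.
under eq_fun do rewrite mxE.
by apply: measurable_funD;
  apply: (measurableT_comp (@measurable_coord R m n i j)).
Qed.

Section safe_set.
Variables (R : realType) (n nP : nat) (m : 'I_nP -> nat).
Variables (nP0 : (0 < nP)%N) (m0 : forall i, (0 < m i)%N).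
Variables (c : forall i, 'I_(m i) -> 'cV[R]_n) (b : forall i, 'I_(m i) -> R).

Lemma measurable_safe_set : measurable (safe_set nP0 m0 c b).
Proof.
have mh : measurable_fun [set: 'cV[R]_n] (hfun nP0 m0 c b).
  apply: measurable_fin_min => i; apply: measurable_fin_max => j.
  by apply: measurable_funB => //; exact: measurable_dotv.
rewrite (_ : safe_set _ _ _ _ = hfun nP0 m0 c b @^-1` `[0, +oo[).
  by rewrite -[X in measurable X]setTI; exact: mh.
by apply/seteqP; split=> x; rewrite /= in_itv/= andbT.
Qed.

Lemma safe_setP x (j : forall i, 'I_(m i)) :
  (forall i, 0 <= dotv (c (j i)) x - b (j i)) -> safe_set nP0 m0 c b x.
Proof.
move=> h; apply/fin_min_ge => i; apply: le_trans (h i) _.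
exact: (fin_max_ge (m0 i) (fun j => dotv (c j) x - b j)).
Qed.

End safe_set.

Lemma dotvD (R : realType) n (c x y : 'cV[R]_n) :
  dotv c (x + y) = dotv c x + dotv c y.
Proof. by rewrite /dotv mulmxDr mxE. Qed.

(** * Exit probability of the closed loop *)

Section closed_loop.
Context (R : realType) (n nu : nat) d (Omega : measurableType d).
Variables (P : probability Omega R) (mu : probability 'cV[R]_n R).
Variables (xi : nat -> Omega -> 'cV[R]_n) (xi_iid : iid_with_law P mu xi).
Variables (S : set 'cV[R]_n) (mS : measurable S).
Variable f : 'cV[R]_n -> 'cV[R]_nu -> 'cV[R]_n.

Lemma exit_prob_le (kap : 'cV[R]_n -> 'cV[R]_nu) N x (a : R) :
  measurable_fun [set: 'cV[R]_n] (fun y => f y (kap y)) -> S x -> 0 <= a ->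
  (forall y, S y -> (a%:E <= mu [set z | S (f y (kap y) + z)%R])%E) ->
  (exit_prob f kap P xi S N x <= (1 - a ^+ N)%:E)%E.
Proof.
move=> mf Sx a0 aP.
pose step (z : 'cV[R]_n * 'cV[R]_n) := f z.1 (kap z.1) + z.2.
have mstep : measurable_fun setT step.
  apply: measurable_addmx => //.
  by apply: (measurableT_comp mf); exact: measurable_fst.
pose xs k w := trajectory f kap (xi ^~ w) x k.
have stay_ge : ((a ^+ N)%:E <= P (stay S xs N))%E.
  exact: (@stay_prob _ _ _ _ _ _ _ P mu xi xi_iid step mstep S mS xs x).
have mstay : measurable (stay S xs N).
  exact: (@measurable_stay _ _ _ _ _ _ _ P mu xi xi_iid step mstep S mS xs x).
rewrite /exit_prob (_ : [set w | _] = ~` stay S xs N).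
  by rewrite probability_setC// EFinB leeB.
apply/seteqP; split=> w.
  by move=> [k [/andP[_ kN] nS]] /(_ k kN).
(* [stay] also constrains time 0, which the exit event ignores; there the state is [x], which lies
   in [S]. *)
move=> nstay; apply: contrapT => nex; apply: nstay => -[//|k] kN.
by apply: contrapT => nS; apply: nex; exists k.+1.
Qed.

Variables (U : set 'cV[R]_nu) (mU : measurable U).
Hypothesis mf : measurable_fun ([set: 'cV[R]_n] `*` U) (fun z => f z.1 z.2).
Context d' (T : measurableType d').
Variable kap : T -> 'cV[R]_n -> 'cV[R]_nu.
Hypothesis mkap : measurable_fun [set: T * 'cV[R]_n] (fun z => kap z.1 z.2).
Hypothesis kapU : forall t y, U (kap t y).

(** [f] is measurable only over inputs in [U], so the composition needs [kapU]. General [t] and [y]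
    cover both a fixed dataset and joint measurability. *)
Lemma measurable_closed_loop d2 (T2 : measurableType d2) (t : T2 -> T)
    (y : T2 -> 'cV[R]_n) :
  measurable_fun [set: T2] t -> measurable_fun [set: T2] y ->
  measurable_fun [set: T2] (fun z => f (y z) (kap (t z) (y z))).
Proof.
move=> mt my.
apply: (@measurable_comp _ _ _ _ _ _ ([set: 'cV[R]_n] `*` U)
  (fun z => f z.1 z.2) _ (fun z => (y z, kap (t z) (y z)))) => //.
- exact: measurableX.
- by move=> _ [z _ <-]; split=> //; exact: kapU.
- apply: measurable_fun_pair => //.
  exact: (measurableT_comp mkap (measurable_fun_pair mt my)).
Qed.

(** The exit probability at [t] is the measure of the section at [t] of a jointly measurable
    event. *)
Lemma measurable_exit_prob N x :
  measurable_fun [set: T] (fun t => exit_prob f (kap t) P xi S N x).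
Proof.
pose g k (z : T * Omega) := trajectory f (kap z.1) (xi ^~ z.2) x k.
have mg k : measurable_fun [set: T * Omega] (g k).
  elim: k => [|k IH]; first exact: measurable_cst.
  apply: measurable_addmx.
    by apply: measurable_closed_loop => //; exact: measurable_fst.
  by have [mxi _ _] := xi_iid; apply: (measurableT_comp (mxi k)).
pose W := [set z : T * Omega | exists k, (1 <= k <= N)%N /\ ~ S (g k z)].
have mW : measurable W.
  have -> : W = \bigcup_(k in [set k | (1 <= k <= N)%N]) (g k @^-1` (~` S)).
    apply/seteqP; split=> z.
      by move=> [k [kN nS]]; exists k.
    by move=> [k kN nS]; exists k.
  apply: bigcup_measurable => k _; rewrite -[X in measurable X]setTI.
  by apply: mg => //; exact: measurableC.
have := measurable_fun_xsection P mW.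
congr measurable_fun; apply/funext => t; rewrite /exit_prob /=; congr (P _).
by apply/seteqP; split=> w; rewrite /xsection /= inE.
Qed.

End closed_loop.

(** * Safety of one step for a good dataset *)

Section one_step.
Variables (R : realType) (n nP : nat) (m : 'I_nP -> nat).
Variables (nP0 : (0 < nP)%N) (m0 : forall i, (0 < m i)%N).
Variables (c : forall i, 'I_(m i) -> 'cV[R]_n) (b : forall i, 'I_(m i) -> R).
Variable mu : probability 'cV[R]_n R.

Lemma one_step_safe (alpha delta : R) (x y : 'cV[R]_n)
    (j : forall i, 'I_(m i)) (Z : 'I_nP -> R) :
  0 <= alpha -> safe_set nP0 m0 c b x ->
  (forall i, dotv (c (j i)) y - btilde nP0 m0 c b alpha (j i) x >= - Z i) ->
  (forall i, mu [set z | (dotv (c (j i)) z < Z i)%R] <= (delta / nP%:R)%:E)%E ->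
  ((1 - delta)%:E <= mu [set z | safe_set nP0 m0 c b (y + z)%R])%E.
Proof.
move=> a0 Sx yZ muZ; set G := [set z | _].
have mG : measurable G.
  rewrite -[X in measurable X]setTI.
  apply: (@measurable_addmx _ _ _ _ _ (cst y) id) => //.
  exact: measurable_safe_set.
have mZ i : measurable [set z | (dotv (c (j i)) z < Z i)%R].
  rewrite (_ : [set _ | _] = dotv (c (j i)) @^-1` `]-oo, Z i[).
    by rewrite -[X in measurable X]setTI; exact: measurable_dotv.
  by apply/seteqP; split=> z; rewrite /= in_itv.
have : (mu (~` G) <= delta%:E)%E.
  apply: (@le_trans _ _ (\sum_(i < nP) (delta / nP%:R)%:E)%E); last first.
    rewrite sumEFin sumr_const card_ord lee_fin -[leLHS]mulr_natr divfK//.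
    by rewrite pnatr_eq0 -lt0n.
  apply: (@le_trans _ _
      (\sum_(i < nP) mu [set z | (dotv (c (j i)) z < Z i)%R])%E).
    apply: measure_finite_cover => //; first exact: measurableC.
    move=> z nGz; apply: contrapT => nex; apply: nGz.
    apply: (@safe_setP _ _ _ _ _ _ _ _ _ j) => i.
    have Zz : Z i <= dotv (c (j i)) z.
      by rewrite leNgt; apply/negP => Zi; apply: nex; exists i.
    have := yZ i; rewrite /btilde dotvD.
    have : 0 <= alpha * hfun nP0 m0 c b x by exact: mulr_ge0.
    by lra.
  by apply: lee_sum => i _; exact: muZ.
rewrite probability_setC// -(fineK (fin_num_measure mu _ mG)) -EFinB !lee_fin.
lra.
Qed.

End one_step.

(** * Datasets with a misleading order statistic *)

Section data_bound.
Variables (R : realType) (n D : nat).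
Variables (mu : probability 'cV[R]_n R) (muD : probability 'M[R]_(n, D) R).
Hypothesis muDP : is_product_measure mu muD.

(** [B] says that fewer than [tau] samples lie at or below the threshold [q]. Covering the
    misleading datasets by such a [B] spares any measurability argument for order statistics. *)
Lemma order_stat_bad_event (c : 'cV[R]_n) (delta gamma : R) :
  0 < delta < 1 -> gamma < 1 -> (1 - delta) ^+ D < gamma ->
  exists B, [/\ measurable B, (muD B <= gamma%:E)%E & forall d, ~ B d ->
    (mu [set z | (dotv c z < order_stat (fun t => dotv c (col t d))
        (binomial_quantile gamma D delta))%R] <= delta%:E)%E].
Proof.
move=> d01 g1 Dg; have [d0 d1] := andP d01.
have [tau0 taug] := binomial_quantileP d01 g1 Dg.
set tau := binomial_quantile _ _ _ in tau0 taug *.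
have [q [qd qP]] := exists_threshold mu (measurable_dotv c) d01.
pose A := [set z | (dotv c z <= q)%R].
have mA : measurable A.
  rewrite (_ : A = dotv c @^-1` `]-oo, q]).
    by rewrite -[X in measurable X]setTI; exact: measurable_dotv.
  by apply/seteqP; split=> z; rewrite /= in_itv.
exists (@count_lt R n D A tau); split.
- exact: measurable_count_lt.
- apply: le_trans (count_lt_prob muDP tau mA) _.
  (* [A] has probability at least [delta], and the tail decreases in the success probability. *)
  rewrite lee_fin (le_trans _ (ltW taug))// binomial_lt_anti ?(ltW d0)//.
    by rewrite -lee_fin fineK// fin_num_measure.
  by rewrite -lee_fin fineK ?fin_num_measure// probability_le1.
- move=> dd nB; rewrite leNgt; apply/negP => /qP/(order_stat_gt tau0) dtau.
  apply: nB; rewrite /count_lt/=; apply: leq_ltn_trans dtau.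
  by apply: subset_leq_card; apply/fintype.subsetP => t; rewrite !inE.
Qed.

End data_bound.

(** * Assembly of the bounds over good datasets *)

Theorem proposition5 (R : realType) (n nu : nat)
  (* inputs and dynamics *)
  (U : set 'cV[R]_nu)
  (U_nonempty : U !=set0) (U_closed : closed U)
  (U_convex : convex_set (U : set (convex_lmodType 'cV[R]_nu)))
  (f : 'cV[R]_n -> 'cV[R]_nu -> 'cV[R]_n)
  (f_measurable :
     measurable_fun ([set: 'cV[R]_n] `*` U) (fun z => f z.1 z.2))
  (* disturbances *)
  (Pxi : probability 'cV[R]_n R)
  (dOmega : measure_display) (Omega : measurableType dOmega)
  (P : probability Omega R) (xi : nat -> Omega -> 'cV[R]_n)
  (xi_iid : iid_with_law P Pxi xi)
  (* safe set *)
  (alpha : R) (alpha01 : 0 <= alpha <= 1)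
  (nP : nat) (nP0 : (0 < nP)%N)
  (m : 'I_nP -> nat) (m0 : forall i, (0 < m i)%N)
  (c : forall i, 'I_(m i) -> 'cV[R]_n) (b : forall i, 'I_(m i) -> R)
  (* confidence parameters and sample size *)
  (N : nat) (N1 : (1 <= N)%N)
  (eps gamma delta : R)
  (eps01 : 0 < eps < 1) (gamma01 : 0 < gamma < 1) (delta01 : 0 < delta < 1)
  (delta_le : delta <= 1 - (1 - eps) `^ (N%:R^-1))
  (deltai : 'I_nP -> R) (deltaiE : forall i, deltai i = delta / nP%:R)
  (ntot : nat) (ntotE : ntot = (\sum_(i < nP) m i)%N)
  (D : nat)
  (D_large :
     fin_max nP0 (fun i => ln (gamma / ntot%:R) / ln (1 - deltai i)) < D%:R)
  (tau : 'I_nP -> nat)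
  (tauE : forall i, tau i = binomial_quantile (gamma / ntot%:R) D (deltai i))
  (* dataset and control law *)
  (PD : probability 'M[R]_(n, D) R) (PD_product : is_product_measure Pxi PD)
  (kap : 'M[R]_(n, D) -> 'cV[R]_n -> 'cV[R]_nu)
  (kap_measurable :
     measurable_fun [set: 'M[R]_(n, D) * 'cV[R]_n] (fun z => kap z.1 z.2))
  (kapU : forall d x, U (kap d x))
  (kap_safe : forall d, law_support PD d ->
     forall x, safe_set nP0 m0 c b x ->
     exists j : forall i, 'I_(m i), forall i,
       dotv (c i (j i)) (f x (kap d x)) - btilde nP0 m0 c b alpha (j i) x >=
         - order_stat (fun t => dotv (c i (j i)) (col t d)) (tau i)) :
  forall x, safe_set nP0 m0 c b x ->
    (PD [set d | (exit_prob f (kap d) P xi (safe_set nP0 m0 c b) N x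
                    <= eps%:E)%E]
       >= (1 - gamma)%:E)%E.
Proof.
move=> x Sx.
have [eps0 eps1] := andP eps01; have [g0 g1] := andP gamma01.
have [d0 d1] := andP delta01; have [a0 a1] := andP alpha01.
have nP1 : 1 <= nP%:R :> R by rewrite ler1n.
have ntot0 : (0 < ntot)%N.
  rewrite ntotE (bigD1 (Ordinal nP0))//= addn_gt0; apply/orP; left.
  exact: m0.
have ntotR : 1 <= ntot%:R :> R by rewrite ler1n.
have di01 i : 0 < deltai i < 1.
  have nPgt0 : 0 < nP%:R :> R by rewrite ltr0n.
  by rewrite deltaiE divr_gt0//= ltr_pdivrMr// mul1r (lt_le_trans d1 nP1).
have gn0 : 0 < gamma / ntot%:R by rewrite divr_gt0// ltr0n.
have gn1 : gamma / ntot%:R < 1.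
  by rewrite ltr_pdivrMr ?ltr0n// mul1r (lt_le_trans g1 ntotR).
have powD i : (1 - deltai i) ^+ D < gamma / ntot%:R.
  have [e0 e1] := andP (di01 i).
  have p0 : 0 < 1 - deltai i by rewrite subr_gt0.
  have ln0 : ln (1 - deltai i) < 0 by rewrite ln_lt0// p0 gtrBl.
  (* Division by the negative [ln (1 - deltai i)] reverses the inequality and gives the sample-size
     bound. *)
  rewrite -ltr_ln ?posrE ?exprn_gt0// lnXn// -[ltLHS]mulr_natl -ltr_ndivrMr//.
  exact: le_lt_trans (fin_max_ge nP0
    (fun i => ln (gamma / ntot%:R) / ln (1 - deltai i)) i) D_large.
have powN : 1 - eps <= (1 - delta) ^+ N.
  have e0 : 0 <= 1 - eps by rewrite subr_ge0 ltW.
  have -> : 1 - eps = ((1 - eps) `^ N%:R^-1) ^+ N.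
    by rewrite -powR_mulrn ?powR_ge0// -powRrM mulVf ?powRr1// pnatr_eq0 -lt0n.
  apply: lerXn2r; rewrite ?nnegrE ?powR_ge0 ?subr_ge0 ?(ltW d1)//.
  by rewrite lerBrDr addrC -lerBrDr.
(* One bad event for every pair, not only for selected indices, because the selection depends on the
   dataset and the state. There are [ntot] pairs, each allowed [gamma / ntot]. *)
have [B BP] := choice (fun ij : {i : 'I_nP & 'I_(m i)} =>
  order_stat_bad_event PD_product (c (tag ij) (tagged ij)) (di01 (tag ij)) gn1
    (powD (tag ij))).
have [G [mG G1 Gsupp]] := law_support_full PD.
pose bad := \bigcup_ij B ij.
have mbad : measurable bad.
  apply: countable_bigcupT_measurable => [|ij]; first exact: countableP.
  by have [] := BP ij.
have bad_le : (PD bad <= gamma%:E)%E.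
  apply: (@le_trans _ _ (\sum_ij PD (B ij))%E).
    apply: measure_finite_cover => // [ij _|d [ij _ dij]]; first by have [] := BP ij.
    by exists ij.
  apply: (@le_trans _ _
      (\sum_(ij : {i : 'I_nP & 'I_(m i)}) (gamma / ntot%:R)%:E)%E).
    by apply: lee_sum => ij _; have [] := BP ij.
  rewrite sumEFin sumr_const lee_fin card_tagged sumnE big_map big_enum/=.
  rewrite (eq_bigr m) => [|i _]; last exact: card_ord.
  by rewrite -ntotE -[leLHS]mulr_natr divfK// pnatr_eq0 -lt0n.
have mexit : measurable [set d | (exit_prob f (kap d) P xi
    (safe_set nP0 m0 c b) N x <= eps%:E)%E].
  rewrite -[X in measurable X]setTI; apply: emeasurable_fun_infty_c => //.
  apply: (measurable_exit_prob xi_iid (measurable_safe_set nP0 m0 c b) _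
    f_measurable kap_measurable kapU).
  exact: closed_mx_measurable.
(* Good datasets lie in [G], hence in the support where [kap_safe] applies, and outside [bad]; the
   complement has measure at most [0 + gamma]. *)
apply: (@le_trans _ _ (PD (G `&` ~` bad))).
  have mGb : measurable (G `&` ~` bad).
    by apply: measurableI => //; exact: measurableC.
  rewrite -[X in PD X]setCK probability_setC; last exact: measurableC.
  rewrite EFinB; apply: leeB => //; rewrite setCI setCK.
  apply: le_trans (measureU2 _ _ _) _ => //; first exact: measurableC.
  by rewrite [X in (X + _)%E]probability_setC// G1 subee// add0e.
apply: le_measure; rewrite ?inE//.
  by apply: measurableI => //; exact: measurableC.
move=> d [Gd nbad] /=.
have mloop : measurable_fun [set: 'cV[R]_n] (fun y => f y (kap d y)).
  apply: (measurable_closed_loop _ f_measurable kap_measurable kapU) => //.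
  exact: closed_mx_measurable.
apply: (@le_trans _ _ (1 - (1 - delta) ^+ N)%:E).
  apply: (exit_prob_le xi_iid (measurable_safe_set nP0 m0 c b)) => //.
    by rewrite subr_ge0 ltW.
  move=> y Sy; have [j jP] := kap_safe d (Gsupp _ Gd) y Sy.
  apply: (one_step_safe (Z := fun i => order_stat
    (fun t => dotv (c i (j i)) (col t d)) (tau i)) a0 Sy) => // i.
  have [_ _ /(_ d)] := BP (Tagged (fun i => 'I_(m i)) (j i)).
  rewrite -(deltaiE i) tauE; apply.
  by move=> Bd; apply: nbad; exists (Tagged (fun i => 'I_(m i)) (j i)).
by rewrite lee_fin; lra.
Qed.
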